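(* Let $\mathscr{Y}$ be a finite non-empty set, let $\overline{\mathscr{L}}_b(\mathscr{Y})\subseteq\mathscr{D}\subseteq\overline{\mathscr{L}}(\mathscr{Y})$, and let $\overline{\mathrm{E}}'\colon\mathscr{D}\to\overline{\mathbb{R}}$ be any map. Then $\overline{\mathrm{E}}'$ is an upper expectation on $\mathscr{D}$ if and only if there is some coherent upper prevision $\overline{\mathrm{E}}$ on $\mathscr{L}(\mathscr{Y})$ such that \[\overline{\mathrm{E}}'(f)=\lim_{c\to+\infty}\overline{\mathrm{E}}(f^{\wedge c})\quad\text{for all } f\in\overline{\mathscr{L}}_b(\mathscr{Y}),\] where $f^{\wedge c}(y)=\min\{f(y),c\}$ for all $y\in\mathscr{Y}$ and $c\in\mathbb{R}$.
   Context: Notation: $\overline{\mathbb{R}}=\mathbb{R}\cup\{-\infty,+\infty\}$, with conventions $+\infty-\infty=-\infty+\infty=+\infty$ and $0\cdot(\pm\infty)=0$; $\mathbb{N}_0=\{0,1,2,\dots\}$. $\overline{\mathscr{L}}(\mathscr{Y})$ is the set of all maps $\mathscr{Y}\to\overline{\mathbb{R}}$, $\overline{\mathscr{L}}_b(\mathscr{Y})$ the subset of those bounded below by a real constant, and $\mathscr{L}(\mathscr{Y})$ the set of gambles, i.e. bounded real-valued maps on $\mathscr{Y}$. Limits and inequalities of functions are pointwise. For $\overline{\mathscr{L}}_b(\mathscr{Y})\subseteq\mathscr{D}\subseteq\overline{\mathscr{L}}(\mathscr{Y})$, an upper expectation on $\mathscr{D}$ is a map $\overline{\mathrm{E}}\colon\mathscr{D}\to\overline{\mathbb{R}}$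 such that: (E1) $\overline{\mathrm{E}}(c)=c$ for all $c\in\mathbb{R}$; (E2) $\overline{\mathrm{E}}(f+g)\le\overline{\mathrm{E}}(f)+\overline{\mathrm{E}}(g)$ for all $f,g\in\overline{\mathscr{L}}_b(\mathscr{Y})$; (E3) $\overline{\mathrm{E}}(\lambda f)=\lambda\overline{\mathrm{E}}(f)$ for all real $\lambda>0$ and $f\in\overline{\mathscr{L}}_b(\mathscr{Y})$; (E4) $f\le g\Rightarrow\overline{\mathrm{E}}(f)\le\overline{\mathrm{E}}(g)$ for all $f,g\in\overline{\mathscr{L}}_b(\mathscr{Y})$; (E5) $\lim_n\overline{\mathrm{E}}(f_n)=\overline{\mathrm{E}}(\lim_n f_n)$ for every non-decreasing sequence $\{f_n\}_{n\in\mathbb{N}_0}$ of non-negative variables in $\overline{\mathscr{L}}_b(\mathscr{Y})$. A coherent upper prevision on $\mathscr{L}(\mathscr{Y})$ is a real-valued map $\overline{\mathrm{E}}$ on $\mathscr{L}(\mathscr{Y})$ such that, for all $f,g\in\mathscr{L}(\mathscr{Y})$ and real $\lambda>0$: (C1) $\overline{\mathrm{E}}(f)\le\sup f$; (C2) $\overline{\mathrm{E}}(f+g)\le\overline{\mathrm{E}}(f)+\overline{\mathrm{E}}(g)$; (C3) $\overline{\mathrm{E}}(\lambda f)=\lambda\overline{\mathrm{E}}(f)$. (Coherent upper previsions are monotone, so the limit over $c\to+\infty$ in the claim exists.) *)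

(* Defs.v *)
From HB Require Import structures.
From mathcomp Require Import all_boot all_order all_algebra.
From mathcomp Require Import all_classical all_reals all_analysis.

Set Implicit Arguments.
Unset Strict Implicit.
Unset Printing Implicit Defensive.

Import Order.TTheory GRing.Theory Num.Theory.
Import numFieldNormedType.Exports.
Local Open Scope classical_set_scope.
Local Open Scope ring_scope.

(* A map defined on a set of functions [D : set (Y -> \bar R)] is a Rocq      *)
(* function out of the subtype [set_type D].  Hence an axiom about [f + g],   *)
(* [lambda f], ... quantifies over the element [h] of the domain whose        *)
(* underlying function is that expression; such an [h] exists because         *)
(* [lower_bounded Y R] (resp. [gambles Y R]) is closed under the operations   *)
(* concerned and is contained in the domain.                                  *)

Definition lower_bounded (Y : Type) (R : realType) : set (Y -> \bar R) :=
  [set f | exists m : R, forall y, (m%:E <= f y)%E].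

Definition gambles (Y : Type) (R : realType) : set (Y -> R) :=
  [set f | exists M : R, forall y, `|f y| <= M].

Arguments lower_bounded : clear implicits.
Arguments gambles : clear implicits.

(* [(_ + _)%dE] is the addition with oo - oo = +oo, whereas [(_ + _)%E]     *)
(* would give -oo.  Multiplication already satisfies 0 * oo = 0.              *)
(* Meant for [lower_bounded Y R `<=` D].                                      *)
Record upper_expectation (Y : Type) (R : realType) (D : set (Y -> \bar R))
    (E : set_type D -> \bar R) : Prop := UpperExpectation {
  upper_expectation_cst : forall (c : R) (f : set_type D),
    val f = (fun=> c%:E) -> E f = c%:E ;
  upper_expectation_sub : forall f g h : set_type D,
    lower_bounded Y R (val f) -> lower_bounded Y R (val g) ->
    val h = (fun y => (val f y + val g y)%dE) ->
    (E h <= (E f + E g)%dE)%E ;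
  upper_expectation_homo : forall (lambda : R) (f h : set_type D),
    0 < lambda -> lower_bounded Y R (val f) ->
    val h = (fun y => (lambda%:E * val f y)%E) ->
    E h = (lambda%:E * E f)%E ;
  upper_expectation_le : forall f g : set_type D,
    lower_bounded Y R (val f) -> lower_bounded Y R (val g) ->
    (forall y, (val f y <= val g y)%E) -> (E f <= E g)%E ;
  upper_expectation_cvg : forall (f_ : nat -> set_type D) (f : set_type D),
    (forall n, lower_bounded Y R (val (f_ n))) ->
    (forall n y, (0 <= val (f_ n) y)%E) ->
    (forall n y, (val (f_ n) y <= val (f_ n.+1) y)%E) ->
    (forall y, val (f_ n) y @[n --> \oo] --> val f y) ->
    E (f_ n) @[n --> \oo] --> E f }.

(* [sup] is the supremum of a non-empty bounded set: meant for non-empty [Y]. *)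
Record coherent_upper_prevision (Y : Type) (R : realType)
    (E : set_type (gambles Y R) -> R) : Prop := CoherentUpperPrevision {
  coherent_le_sup : forall f : set_type (gambles Y R),
    E f <= sup (range (val f)) ;
  coherent_sub : forall f g h : set_type (gambles Y R),
    val h = (fun y => val f y + val g y) -> E h <= E f + E g ;
  coherent_homo : forall (lambda : R) (f h : set_type (gambles Y R)),
    0 < lambda -> val h = (fun y => lambda * val f y) ->
    E h = lambda * E f }.

Section upper_cut.
Variables (Y : Type) (R : realType) (f : Y -> \bar R).
Hypothesis f_lb : lower_bounded Y R f.

Lemma upper_cut_fin (c : R) y : mine (f y) c%:E \is a fin_num.
Proof.
have [m mf] := f_lb; rewrite fin_numElt; apply/andP; split.
- by rewrite lt_min ltNyr andbT; exact: lt_le_trans (ltNyr m) (mf y).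
- by rewrite gt_min ltry orbT.
Qed.

Lemma upper_cut_gamble (c : R) :
  gambles Y R (fun y => fine (mine (f y) c%:E)).
Proof.
have [m mf] := f_lb; exists (`|m| + `|c|) => y.
have le_c : fine (mine (f y) c%:E) <= c.
  by rewrite -lee_fin fineK ?upper_cut_fin// ge_min lexx orbT.
have ge_mc : Num.min m c <= fine (mine (f y) c%:E).
  rewrite -lee_fin fineK ?upper_cut_fin// le_min; apply/andP; split.
  - by apply: le_trans (mf y); rewrite lee_fin ge_min lexx.
  - by rewrite lee_fin ge_min lexx orbT.
rewrite ler_norml; apply/andP; split; last first.
  by apply: le_trans le_c _; apply: le_trans (ler_norm c) _; rewrite lerDr.
apply: le_trans ge_mc; rewrite le_min; apply/andP; split.
- by rewrite lerNl; apply: (le_trans (ler_norm (- m))); rewrite normrN lerDl.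
- by rewrite lerNl; apply: (le_trans (ler_norm (- c))); rewrite normrN lerDr.
Qed.

(* [fine] only changes the type: the minimum is finite by [upper_cut_fin].    *)
Definition upper_cut (c : R) : set_type (gambles Y R) :=
  SigSub (mem_set (upper_cut_gamble c)).

End upper_cut.

(* Main.v *)
(* From an upper expectation, restrict to gambles: translating [f >= m] by    *)
(* [- m] extends continuity from below to sequences bounded below, and the    *)
(* cuts [f /\ n] increase to [f].  Conversely, the limit over [c] is a         *)
(* supremum of values at cuts, through which the axioms pass: subadditivity   *)
(* uses [(f + g) /\ c <= f /\ c' + g /\ c'] for large [c'], and continuity     *)
(* that pointwise convergence of the cuts on the finite set [Y] is uniform.   *)
Require Import Defs.
From mathcomp Require Import all_boot all_order all_algebra.
From mathcomp Require Import all_classical all_reals all_analysis.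
From mathcomp Require Import lra.
Import Order.TTheory GRing.Theory Num.Theory.
Import numFieldNormedType.Exports.
Local Open Scope classical_set_scope.
Local Open Scope ring_scope.

(** Suppose first that [E] is coherent. Writing [f = g + (f - g)] shows that [f <= g + e] gives
    [E f <= E g + e] ([coherent_leD]), so [E] is monotone and stable under uniform errors. Hence
    [E' f] is the supremum of the values of [E] at the cuts of [f] ([coherent_cut_le],
    [coherent_cut_le_ub]), and each axiom becomes an inequality between cuts. Continuity from below
    ([coherent_ext_cvg]) is where finiteness of [Y] enters: some single [f_ n] exceeds a given cut
    of the limit, lowered by [e], at all points at once.

    Conversely, an upper expectation is finite on gambles and coherent there
    ([coherent_of_upper_expectation]). It commutes with adding constants, so continuity holds for
    sequences with any common lower bound ([upper_expectation_cvg_lb]); applied to the integer cuts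
    of [f], it recovers [E' f]. *)

Lemma dadde_fin_numr {R : realType} (x y : \bar R) :
  y \is a fin_num -> (x + y)%dE = (x + y)%E.
Proof. by case: y => // y; case: x. Qed.

(** The two additions differ only when opposite infinities meet, which cannot happen for values
    above [-oo]. *)
Lemma dadde_gtNy {R : realType} (x y : \bar R) :
  (-oo < x)%E -> (-oo < y)%E -> (x + y)%dE = (x + y)%E.
Proof. by case: x => [x||//]; case: y. Qed.

Lemma lower_bounded_cst {R : realType} {Y : Type} (c : R) :
  lower_bounded Y R (fun=> c%:E).
Proof. by exists c. Qed.

(** * Cuts of variables bounded below *)

Section upper_cut_theory.
Context {R : realType} {Y : Type}.
Implicit Types f g h : Y -> \bar R.

Lemma upper_cutE {f} (f_lb : lower_bounded Y R f) c y :
  (val (upper_cut f_lb c) y)%:E = mine (f y) c%:E.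
Proof. by rewrite /= fineK ?upper_cut_fin. Qed.

Lemma upper_cut_lel {f} (f_lb : lower_bounded Y R f) c y :
  ((val (upper_cut f_lb c) y)%:E <= f y)%E.
Proof. by rewrite upper_cutE ge_min lexx. Qed.

Lemma upper_cut_ler {f} (f_lb : lower_bounded Y R f) c y :
  val (upper_cut f_lb c) y <= c.
Proof. by rewrite -lee_fin upper_cutE ge_min lexx orbT. Qed.

(** The bound does not depend on [c]: all cuts at non-negative levels share it. *)
Lemma upper_cut_geN {f} (f_lb : lower_bounded Y R f) {m c y} :
  (m%:E <= f y)%E -> 0 <= c -> - `|m| <= val (upper_cut f_lb c) y.
Proof.
move=> mf c0; rewrite -lee_fin upper_cutE le_min; apply/andP; split.
  by apply: le_trans mf; rewrite lee_fin lerNl -normrN ler_norm.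
by rewrite lee_fin (le_trans _ c0)// oppr_le0.
Qed.

Lemma le_upper_cut {f g} (f_lb : lower_bounded Y R f)
    (g_lb : lower_bounded Y R g) c d :
  (forall y, (f y <= g y)%E) -> c <= d ->
  forall y, val (upper_cut f_lb c) y <= val (upper_cut g_lb d) y.
Proof.
move=> fg cd y; rewrite -lee_fin !upper_cutE le_min !ge_min fg lee_fin cd.
by rewrite orbT.
Qed.

Lemma upper_cut_id {f} (f_lb : lower_bounded Y R f) {c y} :
  (f y <= c%:E)%E -> f y = (val (upper_cut f_lb c) y)%:E.
Proof. by move=> fc; rewrite upper_cutE min_l. Qed.

Lemma upper_cut_ge {f} (f_lb : lower_bounded Y R f) {c y} :
  (c%:E <= f y)%E -> val (upper_cut f_lb c) y = c.
Proof. by move=> cf; apply/EFin_inj; rewrite upper_cutE min_r. Qed.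

Lemma upper_cutD {f g h} (f_lb : lower_bounded Y R f)
    (g_lb : lower_bounded Y R g) (h_lb : lower_bounded Y R h) c :
  h = (fun y => (f y + g y)%dE) ->
  exists c', forall y, val (upper_cut h_lb c) y <=
    val (upper_cut f_lb c') y + val (upper_cut g_lb c') y.
Proof.
move=> hE; have [m mf] := f_lb; have [n ng] := g_lb.
(* If one summand reaches this level, its cut equals it and the other cut is at least [- |m|] or
   [- |n|], so the sum is at least [c]. Otherwise neither summand is altered by its cut. *)
exists (`|c| + `|m| + `|n|) => y.
have hc := upper_cut_ler h_lb c y.
have c_le := ler_norm c; have c_ge0 := normr_ge0 c.
have m_ge0 := normr_ge0 m; have n_ge0 := normr_ge0 n.
have c'_ge0 : 0 <= `|c| + `|m| + `|n| by lra.
have fm := upper_cut_geN f_lb (mf y) c'_ge0.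
have gn := upper_cut_geN g_lb (ng y) c'_ge0.
have [fc|/ltW/(upper_cut_ge f_lb) ->] := leP (f y) (`|c| + `|m| + `|n|)%:E;
  last by lra.
have [gc|/ltW/(upper_cut_ge g_lb) ->] := leP (g y) (`|c| + `|m| + `|n|)%:E;
  last by lra.
rewrite -lee_fin (le_trans (upper_cut_lel _ _ _))// hE.
by rewrite (upper_cut_id f_lb fc) (upper_cut_id g_lb gc).
Qed.

Lemma upper_cutM {f h} (f_lb : lower_bounded Y R f)
    (h_lb : lower_bounded Y R h) (a : R) c :
  0 < a -> h = (fun y => (a%:E * f y)%E) ->
  val (upper_cut h_lb c) = (fun y => a * val (upper_cut f_lb (a^-1 * c)) y).
Proof.
move=> a0 hE; apply/funext => y; apply/EFin_inj.
rewrite EFinM !upper_cutE hE.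
have [fc|/ltW cf] := leP (f y) (a^-1 * c)%:E.
  by rewrite min_l// -lee_pdivlMl.
by rewrite min_r -?EFinM ?mulVKf ?gt_eqF// -lee_pdivrMl.
Qed.

Lemma upper_cut_cvg {f} (f_lb : lower_bounded Y R f) y :
  (val (upper_cut f_lb n%:R) y)%:E @[n --> \oo] --> f y.
Proof.
under eq_fun do rewrite upper_cutE.
have [m /(_ y)] := f_lb; case: (f y) => [r _||//].
  apply: cvg_near_cst; near=> n; rewrite min_l// lee_fin.
  by near: n; exact: nbhs_infty_ger.
move=> _; under eq_fun do rewrite minye.
by apply/cvgenyP; exact: cvg_id.
Unshelve. all: by end_near. Qed.

End upper_cut_theory.

Lemma gamblesB {R : realType} {Y : Type} (f g : set_type (gambles Y R)) :
  gambles Y R (fun y => val f y - val g y).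
Proof.
have [M fM] := set_mem (valP f); have [N gN] := set_mem (valP g).
exists (M + N) => y; rewrite (le_trans (ler_normB _ _))// lerD ?fM ?gN//.
Qed.

Lemma gamblesD {R : realType} {Y : Type} (f g : set_type (gambles Y R)) :
  gambles Y R (fun y => val f y + val g y).
Proof.
have [M fM] := set_mem (valP f); have [N gN] := set_mem (valP g).
exists (M + N) => y; rewrite (le_trans (ler_normD _ _))// lerD ?fM ?gN//.
Qed.

(** * Monotonicity and constants for coherent upper previsions *)

Section coherent_upper_prevision_theory.
Context {R : realType} {Y : Type} (y0 : Y).
Context {E : set_type (gambles Y R) -> R}.
Hypothesis E_coherent : coherent_upper_prevision E.
Implicit Types f g : set_type (gambles Y R).

Lemma coherent_upper_bound {f} {c : R} : (forall y, val f y <= c) -> E f <= c.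
Proof.
move=> fc; apply: le_trans (coherent_le_sup E_coherent f) _.
by apply: ge_sup => [|_ [y _ <-]]; [exists (val f y0), y0|exact: fc].
Qed.

Lemma coherent_leD {f g} {e : R} :
  (forall y, val f y <= val g y + e) -> E f <= E g + e.
Proof.
move=> fge; pose d : set_type (gambles Y R) := SigSub (mem_set (gamblesB f g)).
have fE : val f = (fun y => val g y + val d y).
  by apply/funext => y; rewrite addrC subrK.
rewrite (le_trans (coherent_sub E_coherent fE))// lerD2l.
by apply: coherent_upper_bound => y /=; rewrite lerBlDl; exact: fge.
Qed.

Lemma coherent_le {f g} : (forall y, val f y <= val g y) -> E f <= E g.
Proof.
by move=> fg; rewrite -[leRHS]addr0; apply: coherent_leD => y; rewrite addr0.
Qed.

Lemma coherent_cst {f} {c : R} : (forall y, val f y = c) -> E f = c.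
Proof.
move=> fc; have f_le : E f <= c by apply: coherent_upper_bound => y; rewrite fc.
(* The lower bound comes from doubling: [f <= 2 f - c] yields [E f <= 2 E f - c], that is
   [c <= E f]. *)
have h_gamble : gambles Y R (fun y => 2 * val f y).
  by exists (2 * `|c|) => y; rewrite fc normrM ger0_norm.
pose h : set_type (gambles Y R) := SigSub (mem_set h_gamble).
have hE : E h = 2 * E f by exact: (coherent_homo E_coherent).
have : E f <= E h - c by apply: coherent_leD => y /=; rewrite fc; lra.
by rewrite hE => ?; lra.
Qed.

End coherent_upper_prevision_theory.

(** * From a coherent upper prevision to an upper expectation *)

Section upper_expectation_of_coherent.
Context {R : realType} {Y : finType} (y0 : Y) {D : set (Y -> \bar R)}.
Context {E : set_type (gambles Y R) -> R} {E' : set_type D -> \bar R}.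
Hypothesis E_coherent : coherent_upper_prevision E.
Hypothesis E_cvg : forall (f : set_type D) (f_lb : lower_bounded Y R (val f)),
  (E (upper_cut f_lb c))%:E @[c --> +oo%R] --> E' f.
Implicit Types f g h : set_type D.

Lemma coherent_cut_le {f} (f_lb : lower_bounded Y R (val f)) c :
  ((E (upper_cut f_lb c))%:E <= E' f)%E.
Proof.
apply: (cvge_ge _ (E_cvg _ f_lb)); near=> d; rewrite lee_fin.
apply: (coherent_le y0 E_coherent); apply: le_upper_cut => [y|].
  exact: lexx.
by near: d; apply: nbhs_pinfty_ge; rewrite num_real.
Unshelve. all: by end_near. Qed.

Lemma coherent_cut_le_ub {f} (f_lb : lower_bounded Y R (val f)) (u : \bar R) :
  (forall c, ((E (upper_cut f_lb c))%:E <= u)%E) -> (E' f <= u)%E.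
Proof. by move=> fu; apply: (cvge_le _ (E_cvg _ f_lb)); exact: nearW. Qed.

Lemma upper_expectation_gtNy {f} : lower_bounded Y R (val f) -> (-oo < E' f)%E.
Proof.
by move=> f_lb; apply: lt_le_trans (coherent_cut_le f_lb 0); rewrite ltNyr.
Qed.

Lemma coherent_ext_cst (c : R) f : val f = (fun=> c%:E) -> E' f = c%:E.
Proof.
move=> fE; have f_lb : lower_bounded Y R (val f) by exists c; rewrite fE.
apply: cvg_unique (E_cvg _ f_lb) _ => //.
apply: cvg_near_cst; near=> d; congr EFin.
apply: (coherent_cst y0 E_coherent) => y; apply/EFin_inj.
rewrite -upper_cut_id fE// lee_fin.
by near: d; apply: nbhs_pinfty_ge; rewrite num_real.
Unshelve. all: by end_near. Qed.

Lemma coherent_ext_le f g :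
  lower_bounded Y R (val f) -> lower_bounded Y R (val g) ->
  (forall y, (val f y <= val g y)%E) -> (E' f <= E' g)%E.
Proof.
move=> f_lb g_lb fg; apply: (coherent_cut_le_ub f_lb) => c.
apply: le_trans (coherent_cut_le g_lb c); rewrite lee_fin.
by apply: (coherent_le y0 E_coherent); exact: le_upper_cut.
Qed.

Lemma coherent_ext_sub f g h :
  lower_bounded Y R (val f) -> lower_bounded Y R (val g) ->
  val h = (fun y => (val f y + val g y)%dE) ->
  (E' h <= (E' f + E' g)%dE)%E.
Proof.
move=> f_lb g_lb hE.
have h_lb : lower_bounded Y R (val h).
  have [[m mf] [n ng]] := (f_lb, g_lb); exists (m + n) => y.
  have [fy gy] := (lt_le_trans (ltNyr m) (mf y), lt_le_trans (ltNyr n) (ng y)).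
  by rewrite hE dadde_gtNy// EFinD leeD.
rewrite dadde_gtNy ?upper_expectation_gtNy//.
apply: (coherent_cut_le_ub h_lb) => c.
have [c' hc'] := upper_cutD f_lb g_lb h_lb c hE.
apply: le_trans (leeD (coherent_cut_le f_lb c') (coherent_cut_le g_lb c')).
(* The sum of the two cuts is the gamble to which monotonicity and then subadditivity of [E]
   apply. *)
pose s : set_type (gambles Y R) := SigSub (mem_set
  (gamblesD (upper_cut f_lb c') (upper_cut g_lb c'))).
rewrite -EFinD lee_fin; apply: (@le_trans _ _ (E s)).
  exact: (coherent_le y0 E_coherent).
exact: (coherent_sub E_coherent).
Qed.

(** One inequality suffices: the reverse follows by applying it to [h] with factor [a^-1]. *)
Lemma coherent_ext_homo_le (a : R) f h :
  0 < a -> lower_bounded Y R (val f) -> lower_bounded Y R (val h) ->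
  val h = (fun y => (a%:E * val f y)%E) -> (E' h <= a%:E * E' f)%E.
Proof.
move=> a0 f_lb h_lb hE; apply: (coherent_cut_le_ub h_lb) => c.
rewrite (coherent_homo E_coherent a0 (upper_cutM f_lb h_lb _ c a0 hE)).
by rewrite EFinM lee_pmul2l// coherent_cut_le.
Qed.

Lemma coherent_ext_homo (a : R) f h :
  0 < a -> lower_bounded Y R (val f) ->
  val h = (fun y => (a%:E * val f y)%E) -> E' h = (a%:E * E' f)%E.
Proof.
move=> a0 f_lb hE.
have h_lb : lower_bounded Y R (val h).
  have [m mf] := f_lb; exists (a * m) => y.
  by rewrite hE EFinM lee_pmul2l.
apply/eqP; rewrite eq_le coherent_ext_homo_le//= -lee_pdivlMl//.
apply: coherent_ext_homo_le => //; first by rewrite invr_gt0.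
by apply/funext => y; rewrite hE muleA -EFinM mulVf ?gt_eqF// mul1e.
Qed.

Lemma coherent_ext_cvg (f_ : nat -> set_type D) f :
  (forall n, lower_bounded Y R (val (f_ n))) ->
  (forall n y, (0 <= val (f_ n) y)%E) ->
  (forall n y, (val (f_ n) y <= val (f_ n.+1) y)%E) ->
  (forall y, val (f_ n) y @[n --> \oo] --> val f y) ->
  E' (f_ n) @[n --> \oo] --> E' f.
Proof.
move=> f_lb f_ge0 f_nd f_cvg.
have f_le n y : (val (f_ n) y <= val f y)%E.
  apply: (cvge_ge _ (f_cvg y)); near=> k.
  have /nondecreasing_seqP : forall n, (val (f_ n) y <= val (f_ n.+1) y)%E.
    by [].
  by apply; near: k; exact: nbhs_infty_ge.
have fl_lb : lower_bounded Y R (val f).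
  by exists 0 => y; exact: le_trans (f_ge0 0%N y) (f_le 0%N y).
have E'_nd : nondecreasing_seq (fun n => E' (f_ n)).
  by apply/nondecreasing_seqP => n; exact: coherent_ext_le.
suff -> : E' f = ereal_sup (range (fun n => E' (f_ n))).
  exact: ereal_nondecreasing_cvgn.
apply/eqP; rewrite eq_le; apply/andP; split; last first.
  by apply: ge_ereal_sup => _ [n _ <-]; exact: coherent_ext_le.
apply: (coherent_cut_le_ub fl_lb) => c; apply/lee_addgt0Pr => e e0.
have [n hn] : exists n, forall y,
    ((val (upper_cut fl_lb c) y - e)%:E < val (f_ n) y)%E.
  suff : \forall n \near \oo, forall y,
      ((val (upper_cut fl_lb c) y - e)%:E < val (f_ n) y)%E.
    by case=> n _ hn; exists n; exact: hn n (leqnn n).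
  (* [Y] is finite, so the ranks that work for each point have a common one. *)
  apply: filter_forall => y.
  (* Subtracting [e] makes the inequality strict at the limit, hence an open condition, also where
     [f] is infinite. *)
  suff : nbhs (val f y) [set z | ((val (upper_cut fl_lb c) y - e)%:E < z)%E].
    exact: f_cvg.
  apply: open_nbhs_nbhs; split; first exact: open_ereal_gt_ereal.
  apply: lt_le_trans (upper_cut_lel fl_lb c y).
  by rewrite lte_fin ltrBlDr ltrDl.
apply: (@le_trans _ _ ((E (upper_cut (f_lb n) c))%:E + e%:E)%E).
  rewrite -EFinD lee_fin; apply: (coherent_leD y0 E_coherent) => y.
  rewrite -lerBlDr -lee_fin upper_cutE le_min; apply/andP; split.
    exact: ltW (hn y).
  by rewrite lee_fin lerBlDr (le_trans (upper_cut_ler _ _ _))// lerDl ltW.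
rewrite leeD2r// (le_trans (coherent_cut_le _ _))//.
by apply: ereal_sup_ubound; exists n.
Unshelve. all: by end_near. Qed.

Lemma upper_expectation_of_coherent : upper_expectation E'.
Proof.
split.
- exact: coherent_ext_cst.
- exact: coherent_ext_sub.
- exact: coherent_ext_homo.
- exact: coherent_ext_le.
- exact: coherent_ext_cvg.
Qed.

End upper_expectation_of_coherent.

(** * From an upper expectation to a coherent upper prevision *)

Section coherent_of_upper_expectation.
Context {R : realType} {Y : Type} {D : set (Y -> \bar R)}.
Hypothesis lbD : lower_bounded Y R `<=` D.
Context {E' : set_type D -> \bar R}.
Hypothesis E'_upper : upper_expectation E'.

Let ext {f : Y -> \bar R} (f_lb : lower_bounded Y R f) : set_type D :=
  SigSub (mem_set (lbD _ f_lb)).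

(** Subadditivity against the constant [a] gives one inequality; translating back by [- a] gives the
    other. *)
Lemma upper_expectation_translate (f h : set_type D) (a : R) :
  lower_bounded Y R (val f) ->
  val h = (fun y => (val f y + a%:E)%E) -> E' h = (E' f + a%:E)%E.
Proof.
have le_translate (f1 h1 : set_type D) b : lower_bounded Y R (val f1) ->
    val h1 = (fun y => (val f1 y + b%:E)%E) -> (E' h1 <= E' f1 + b%:E)%E.
  move=> f1_lb h1E; rewrite -dadde_fin_numr//.
  rewrite -(upper_expectation_cst E'_upper
    (f := ext (lower_bounded_cst b)) erefl).
  by apply: (upper_expectation_sub E'_upper) => //; exact: lower_bounded_cst.
move=> f_lb hE.
have h_lb : lower_bounded Y R (val h).
  by have [m mf] := f_lb; exists (m + a) => y; rewrite hE EFinD leeD2r.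
apply/eqP; rewrite eq_le le_translate//= -leeBrDr// -EFinN le_translate//.
by apply/funext => y; rewrite hE EFinN addeK.
Qed.

(** Subtracting [m] makes the sequence non-negative, and adding the finite [m] back preserves
    limits. *)
Lemma upper_expectation_cvg_lb (m : R) (f_ : nat -> set_type D)
    (f : set_type D) :
  (forall n y, (m%:E <= val (f_ n) y)%E) ->
  (forall n y, (val (f_ n) y <= val (f_ n.+1) y)%E) ->
  (forall y, (m%:E <= val f y)%E) ->
  (forall y, val (f_ n) y @[n --> \oo] --> val f y) ->
  E' (f_ n) @[n --> \oo] --> E' f.
Proof.
move=> f_m f_nd fm f_cvg.
have sub_lb (g : set_type D) : (forall y, (m%:E <= val g y)%E) ->
    lower_bounded Y R (fun y => (val g y + (- m)%:E)%E).
  by move=> mg; exists 0 => y; rewrite EFinN sube_ge0.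
have E'E (g : set_type D) (mg : forall y, (m%:E <= val g y)%E) :
    E' g = (E' (ext (sub_lb g mg)) + m%:E)%E.
  apply: upper_expectation_translate; first exact: (sub_lb _).
  by apply/funext => y /=; rewrite EFinN subeK.
rewrite (E'E f fm); under eq_fun do rewrite (E'E (f_ _) (f_m _)).
apply: cvgeD; [by rewrite fin_num_adde_defl| |exact: cvg_cst].
apply: (upper_expectation_cvg E'_upper) => [n|n y|n y|y] /=.
- exact: (sub_lb _).
- by rewrite EFinN sube_ge0//; exact: f_m.
- by apply: leeD2r; exact: f_nd.
- by apply: cvgeD; [rewrite fin_num_adde_defl|exact: f_cvg|exact: cvg_cst].
Qed.

Lemma lower_bounded_EFin (f : set_type (gambles Y R)) :
  lower_bounded Y R (EFin \o val f).
Proof.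
have [M fM] := set_mem (valP f); exists (- M) => y /=.
by rewrite lee_fin; have := fM y; rewrite ler_norml => /andP[].
Qed.

Let embed f := ext (lower_bounded_EFin f).
Let E f := fine (E' (embed f)).

(** Monotonicity squeezes the value between those of the constants [- M] and [M], so [fine] in [E]
    loses nothing. *)
Lemma upper_expectation_gamble_fin f : E' (embed f) \is a fin_num.
Proof.
have [M fM] := set_mem (valP f).
have [lo up] : ((- M)%:E <= E' (embed f))%E /\ (E' (embed f) <= M%:E)%E.
  split.
    rewrite -(upper_expectation_cst E'_upper
      (f := ext (lower_bounded_cst (- M))) erefl).
    apply: (upper_expectation_le E'_upper) => [||y].
        exact: lower_bounded_cst.
      exact: lower_bounded_EFin.
    by rewrite lee_fin; have := fM y; rewrite ler_norml => /andP[].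
  rewrite -(upper_expectation_cst E'_upper
    (f := ext (lower_bounded_cst M)) erefl).
  apply: (upper_expectation_le E'_upper) => [||y].
    exact: lower_bounded_EFin.
  exact: lower_bounded_cst.
  by rewrite lee_fin; have := fM y; rewrite ler_norml => /andP[].
by rewrite fin_numElt (lt_le_trans (ltNyr _) lo) (le_lt_trans up (ltry _)).
Qed.

Lemma upper_expectation_gambleE f : (E f)%:E = E' (embed f).
Proof. by rewrite fineK ?upper_expectation_gamble_fin. Qed.

Lemma coherent_of_upper_expectation : coherent_upper_prevision E.
Proof.
split=> [f|f g h hE|a f h a0 hE].
- rewrite -lee_fin upper_expectation_gambleE.
  rewrite -(upper_expectation_cst E'_upper
    (f := ext (lower_bounded_cst _)) erefl).
  apply: (upper_expectation_le E'_upper) => [||y].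
    exact: lower_bounded_EFin.
  exact: lower_bounded_cst.
  rewrite lee_fin; apply: ub_le_sup; last by exists y.
  have [M fM] := set_mem (valP f).
  by exists M => _ [z _ <-]; exact: le_trans (ler_norm _) (fM z).
- rewrite -lee_fin EFinD !upper_expectation_gambleE.
  rewrite -dadde_fin_numr ?upper_expectation_gamble_fin//.
  apply: (upper_expectation_sub E'_upper); [exact: lower_bounded_EFin..|].
  by apply/funext => y /=; rewrite hE.
- apply/EFin_inj; rewrite EFinM !upper_expectation_gambleE.
  apply: (upper_expectation_homo E'_upper) => //.
    exact: lower_bounded_EFin.
  by apply/funext => y /=; rewrite hE.
Qed.

Lemma upper_expectation_cut_cvg (f : set_type D)
    (f_lb : lower_bounded Y R (val f)) :
  (E (upper_cut f_lb c))%:E @[c --> +oo%R] --> E' f.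
Proof.
have E_nd : {homo (fun c : R => (E (upper_cut f_lb c))%:E) :
    c d / c <= d >-> (c <= d)%E}.
  move=> c d cd; rewrite !upper_expectation_gambleE.
  apply: (upper_expectation_le E'_upper); [exact: lower_bounded_EFin..|].
  by move=> y /=; rewrite lee_fin; exact: le_upper_cut.
(* Monotonicity in [c] already ensures a limit over the reals, so the limit along the integers
   identifies it. *)
suff E_cvgn : (E (upper_cut f_lb n%:R))%:E @[n --> \oo] --> E' f.
  have E_cvg := nondecreasing_cvge E_nd.
  have /cvge_pinftyP/(_ _ cvgr_idn) E_cvgn' := E_cvg.
  by rewrite (cvg_unique _ E_cvgn E_cvgn').
under eq_fun do rewrite upper_expectation_gambleE.
have [m mf] := f_lb.
apply: (@upper_expectation_cvg_lb (- `|m|)) => [n y|n y|y|y] /=.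
- by rewrite lee_fin; apply: (upper_cut_geN f_lb (mf y)); exact: ler0n.
- by rewrite lee_fin; apply: (le_upper_cut f_lb f_lb) => [z|]; rewrite ?ler_nat.
- by apply: le_trans (mf y); rewrite lee_fin lerNl -normrN ler_norm.
- exact: upper_cut_cvg.
Qed.

End coherent_of_upper_expectation.

Theorem proposition7 (R : realType) (Y : finType) (Y_gt0 : (0 < #|Y|)%N)
    (D : set (Y -> \bar R)) (lbD : lower_bounded Y R `<=` D)
    (E' : set_type D -> \bar R) :
  upper_expectation E' <->
  exists E : set_type (gambles Y R) -> R,
    coherent_upper_prevision E /\
    forall (f : set_type D) (f_lb : lower_bounded Y R (val f)),
      (E (upper_cut f_lb c))%:E @[c --> +oo%R] --> E' f.
Proof.
split=> [E'_upper|[E [E_coherent E_cvg]]].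
  eexists; split; first exact: (coherent_of_upper_expectation lbD E'_upper).
  exact: upper_expectation_cut_cvg.
have [y0 _] := card_gt0P Y_gt0.
exact: (upper_expectation_of_coherent y0 E_coherent).
Qed.
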